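(* Let $\Gamma$ be a straight-line planar drawing of a triconnected plane graph $G=(V,E)$, with vertex positions $\gamma_i\in\mathbb{R}^2$ ($i\in V$), such that the vertices on the convex hull of $\{\gamma_i : i\in V\}$ form the outer face of $G$. Then $\Gamma$ is a weighted barycenter drawing if and only if there are real numbers $z_{ij}>0$, one for each internal vertex $i$ and each $j\in N(i)$ (not necessarily with $z_{ij}=z_{ji}$), satisfying $$\sum_{j\in N(i)} z_{ij}=1\quad\text{and}\quad\gamma_i=\sum_{j\in N(i)} z_{ij}\gamma_j\qquad\text{for each internal vertex } i,$$ such that for every strictly internal face $C=(v_0,v_1,\ldots,v_{k-1},v_k=v_0)$ of $G$ $$\prod_{i=0}^{k-1} z_{v_i,v_{i+1}}=\prod_{i=1}^{k} z_{v_i,v_{i-1}}.$$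
   Context: $N(i)$ denotes the set of neighbours of $i$ in $G$. $F_0$ denotes the outer face of $G$. A vertex is external if it lies on $F_0$ and internal otherwise. An edge is internal if it is incident to at least one internal vertex. A face is strictly internal if every vertex incident to it is internal; a face is identified with its boundary cycle, listed in cyclic order. The drawing $\Gamma$ is a weighted barycenter drawing if there is a real weight $w_{ij}=w_{ji}>0$ for each internal edge $(i,j)$ such that for each internal vertex $i$ $$\gamma_i=\frac{1}{\sum_{j\in N(i)} w_{ij}}\sum_{j\in N(i)} w_{ij}\gamma_j .$$ *)

(* Defs.v *)
From mathcomp Require Import all_boot all_order all_algebra.
From mathcomp Require Import fingroup perm.
From mathcomp Require Import all_classical all_reals all_analysis.

Set Implicit Arguments.
Unset Strict Implicit.
Unset Printing Implicit Defensive.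

Import Order.TTheory GRing.Theory Num.Theory.
Import numFieldNormedType.Exports.
Local Open Scope ring_scope.

(* A finite simple graph with, for each vertex v, a cyclic permutation of its *)
(* neighbours: rot v u is the neighbour that follows u in clockwise order     *)
(* around v.  That the neighbourhood of v is a single cycle of rot v is       *)
(* rotation_cycle; the values of rot v outside it play no role.               *)
Record rotation_system (V : finType) := RotationSystem {
  adj : rel V;
  adj_sym : symmetric adj;
  adj_irr : irreflexive adj;
  rot : V -> {perm V};
  rotation_cycle : forall v u : V,
    adj v u -> porbit (rot v) u = [set w | adj v w]%SET
}.

Section Faces.
Variables (V : finType) (G : rotation_system V).

(* A dart (u, v) is the edge uv directed from u to v: every edge carries two  *)
(* darts.                                                                     *)
Definition darts : {set V * V} := [set d : V * V | adj G d.1 d.2]%SET.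

(* Arriving at v from u, leave along the neighbour of v that is next after u  *)
(* in clockwise order; this traverses the boundary of the face lying to the   *)
(* left of (u, v).  The faces are the orbits of darts, each dart belonging to *)
(* exactly one face.                                                          *)
Definition face_next (d : V * V) : V * V := (d.2, rot G d.2 d.1).

Definition face_of (d : V * V) : {set V * V} :=
  [set d' | fconnect face_next d d']%SET.

Definition faces : {set {set V * V}} := (face_of @: darts)%SET.

(* The boundary cycle of the face of d is v_0, ..., v_{k-1}, v_k = v_0 with   *)
(* v_i = face_vertex d i and k = face_length d.                               *)
Definition face_vertex (d : V * V) (i : nat) : V := (iter i face_next d).1.

Definition face_length (d : V * V) : nat := fingraph.order face_next d.

End Faces.

(* A plane graph, as a connected graph with a combinatorial embedding of      *)
(* genus 0 (#V - #E + #F = 2) and a distinguished outer face, given by one of *)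
(* its darts.                                                                 *)
Record plane_graph (V : finType) := PlaneGraph {
  pg_rotation :> rotation_system V;
  pg_connected : forall u v : V, connect (adj pg_rotation) u v;
  pg_genus0 : (#|V| + #|faces pg_rotation| = #|darts pg_rotation|./2 + 2)%N;
  pg_outer : V * V;
  pg_outer_dart : pg_outer \in darts pg_rotation
}.

Section PlaneGraphs.
Variables (V : finType) (G : plane_graph V).

Definition outer_face : {set V * V} := face_of G (pg_outer G).

Definition external (i : V) : bool := [exists d in outer_face, d.1 == i].

Definition internal (i : V) : bool := ~~ external i.

Definition internal_edge (i j : V) : bool :=
  adj G i j && (internal i || internal j).

Definition strictly_internal_face (d : V * V) : bool :=
  [forall d' in face_of G d, internal d'.1].

Definition triconnected : Prop :=
  (3 < #|V|)%N /\
  forall S : {set V}, (#|S| < 3)%N ->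
  forall u v : V, u \notin S -> v \notin S ->
  connect [rel a b | [&& adj G a b, a \notin S & b \notin S]] u v.

End PlaneGraphs.

Section Plane.
Variable R : realType.
Implicit Types (p q : 'rV[R]_2) (A : set 'rV[R]_2).

Definition segment p q : set 'rV[R]_2 :=
  [set x | exists2 t : R, 0 <= t <= 1 & x = (1 - t) *: p + t *: q]%classic.

Definition frontier A : set 'rV[R]_2 := (closure A `\` interior A)%classic.

Definition rotate_cw (t : R) p : 'rV[R]_2 :=
  \row_(k < 2) if k == ord0 then cos t * p 0 0 + sin t * p 0 1
               else cos t * p 0 1 - sin t * p 0 0.

(* t in ]0, 2 pi] is the clockwise angle from the direction of p to that of   *)
(* q; it is 2 pi, not 0, when the directions agree.                           *)
Definition cw_angle p q (t : R) : Prop :=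
  0 < t <= 2 * pi /\ exists2 r : R, 0 < r & q = r *: rotate_cw t p.

Definition convex_hull (V : finType) (gamma : V -> 'rV[R]_2) : set 'rV[R]_2 :=
  [set x | exists t : V -> R, [/\ forall i, 0 <= t i, \sum_i t i = 1
                                & x = \sum_i t i *: gamma i]]%classic.

End Plane.

Section Drawings.
Variables (R : realType) (V : finType) (G : plane_graph V).
Variable gamma : V -> 'rV[R]_2.

Definition drawn_edges (D : {set V * V}) : set 'rV[R]_2 :=
  [set x | exists2 d, d \in D & segment (gamma d.1) (gamma d.2) x]%classic.

Definition unbounded_region : set 'rV[R]_2 :=
  let C := (~` drawn_edges (darts G))%classic in
  [set x | C x /\ ~ bounded_set (connected_component C x)]%classic.

(* Drawings of the plane graph, and not merely of the underlying graph: they  *)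
(* must realise its rotation system and its outer face.                       *)
Record straight_line_planar_drawing : Prop := StraightLinePlanarDrawing {
  drawing_inj : injective gamma;
  drawing_vertex_edge : forall a b v : V, adj G a b ->
    segment (gamma a) (gamma b) (gamma v) -> v = a \/ v = b;
  drawing_edge_edge : forall (a b c d : V) (x : 'rV[R]_2),
    adj G a b -> adj G c d -> [set a; b]%SET <> [set c; d]%SET ->
    segment (gamma a) (gamma b) x -> segment (gamma c) (gamma d) x ->
    exists2 v, v \in ([set a; b] :&: [set c; d])%SET & x = gamma v;
  (* turning clockwise around v from the edge vu, the edge to rot v u is met  *)
  (* first                                                                    *)
  drawing_rotation : forall (v u w : V) (s t : R), adj G v u -> adj G v w ->
    cw_angle (gamma u - gamma v) (gamma (rot G v u) - gamma v) s ->
    cw_angle (gamma u - gamma v) (gamma w - gamma v) t -> s <= t;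
  drawing_outer : frontier unbounded_region = drawn_edges (outer_face G)
}.

Definition hull_is_outer_face : Prop :=
  forall i : V, frontier (convex_hull gamma) (gamma i) <-> external G i.

Definition weighted_barycenter_drawing : Prop :=
  exists w : V -> V -> R,
    (forall i j, internal_edge G i j -> w i j = w j i /\ 0 < w i j) /\
    (forall i, internal G i ->
       gamma i = (1 / \sum_(j | adj G i j) w i j) *:
                   \sum_(j | adj G i j) w i j *: gamma j).

End Drawings.

(* Main.v *)
Require Import Defs.
From mathcomp Require Import all_boot all_order all_algebra.
From mathcomp Require Import fingroup perm.
From mathcomp Require Import all_classical all_reals all_analysis.
From mathcomp Require Import zify ring lra.

Set Implicit Arguments.
Unset Strict Implicit.
Unset Printing Implicit Defensive.

Import Order.TTheory GRing.Theory Num.Theory.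
Local Open Scope ring_scope.

(* From symmetric weights w, put z i j = w i j / s i with s i the sum of the  *)
(* w i j; on a face the w's cancel by symmetry and the s's cyclically.        *)
(* Conversely one needs c with exp (c i) * z i j = exp (c j) * z j i for all  *)
(* adjacent internal i, j, that is, a potential for the 1-form                *)
(* ln (z i j / z j i) on the subgraph of internal vertices.  The face         *)
(* condition says that this form integrates to 0 around strictly internal     *)
(* faces; since the embedding has genus 0, their boundaries generate all      *)
(* circulations of that subgraph.                                             *)

(** That face boundaries generate all circulations comes from a Hodge decomposition: in genus 0,
    every antisymmetric function on darts is a gradient plus a boundary of faces
    ([hodge_decomposition]). Gradients are orthogonal to circulations and to boundaries, and over an
    ordered field a vector orthogonal to itself is zero, so a circulation is a pure boundary
    ([circulation_boundary]). The Fredholm alternative then yields the potential [c]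
    ([internal_potential]), and the weights are [expR (c i) * z i j]. *)

Lemma sum_enum_val (M : nmodType) (I : finType) (F : I -> M) :
  \sum_i F i = \sum_(k < #|I|) F (enum_val k).
Proof. exact: (big_enum_val (A := predT)). Qed.

(** The row space of a matrix is the annihilator of its kernel; the columns of the cokernel matrix
    serve as test vectors [x]. *)
Lemma fredholm_alternative (F : fieldType) (I J : finType) (b : I -> J -> F)
    (y : J -> F) :
  (forall x : J -> F, (forall i, \sum_j b i j * x j = 0) ->
     \sum_j y j * x j = 0) ->
  exists c : I -> F, forall j, y j = \sum_i c i * b i j.
Proof.
move=> orth.
pose B : 'M[F]_(#|I|, #|J|) := \matrix_(i, j) b (enum_val i) (enum_val j).
pose Y : 'rV[F]_#|J| := \row_j y (enum_val j).
have : (Y <= B)%MS.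
  rewrite submxE; apply/eqP/matrixP => i k; rewrite [RHS]mxE mxE.
  pose x j := cokermx B (enum_rank j) k.
  rewrite -[RHS](orth x); last first.
    move=> i'; have /matrixP/(_ (enum_rank i') k) := mulmx_coker B.
    rewrite [RHS]mxE mxE => B0; rewrite -[RHS]B0 (sum_enum_val (I := J)).
    by apply: eq_bigr => j _; rewrite /x !mxE enum_rankK enum_valK.
  rewrite (sum_enum_val (I := J)).
  by apply: eq_bigr => j _; rewrite /x mxE enum_valK.
case/submxP => C /matrixP YCB; exists (fun i => C 0 (enum_rank i)) => j.
have := YCB 0 (enum_rank j); rewrite !mxE enum_rankK => ->.
rewrite [RHS](sum_enum_val (I := I)).
by apply: eq_bigr => i _; rewrite mxE enum_rankK enum_valK.
Qed.

(** Rank-nullity: a kernel spanned by [#|K|] vectors leaves rank at least [#|I| - #|K|], hence full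
    rank [#|J|]. *)
Lemma surjective_of_small_kernel (F : fieldType) (I J K : finType)
    (b : I -> J -> F) (e : K -> I -> F) :
  (forall x : I -> F, (forall j, \sum_i x i * b i j = 0) ->
     exists t : K -> F, forall i, x i = \sum_k t k * e k i) ->
  (#|J| + #|K| <= #|I|)%N ->
  forall y : J -> F, exists x : I -> F, forall j, y j = \sum_i x i * b i j.
Proof.
move=> ker leJI y.
pose B : 'M[F]_(#|I|, #|J|) := \matrix_(i, j) b (enum_val i) (enum_val j).
pose E : 'M[F]_(#|K|, #|I|) := \matrix_(k, i) e (enum_val k) (enum_val i).
have leE : (kermx B <= E)%MS.
  apply/row_subP => l.
  have [|t tE] := ker (fun i => kermx B l (enum_rank i)).
    move=> j; have /matrixP/(_ l (enum_rank j)) := mulmx_ker B.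
    rewrite [RHS]mxE mxE => B0; rewrite -[RHS]B0 (sum_enum_val (I := I)).
    by apply: eq_bigr => i _; rewrite !mxE enum_rankK enum_valK.
  apply/submxP; exists (\row_k t (enum_val k)); apply/matrixP => i0 i.
  rewrite mxE [RHS]mxE -[in LHS](enum_valK i) tE (sum_enum_val (I := K)).
  by apply: eq_bigr => k _; rewrite !mxE.
have fullB : row_full B.
  rewrite /row_full eqn_leq rank_leq_col /=.
  have := leq_trans (mxrankS leE) (rank_leq_row E); rewrite mxrank_ker.
  rewrite leq_subLR => /(leq_trans leJI).
  by rewrite leq_add2r.
have /submxP[C /matrixP YCB] := submx_full (\row_j y (enum_val j)) fullB.
exists (fun i => C 0 (enum_rank i)) => j.
have := YCB 0 (enum_rank j); rewrite !mxE enum_rankK => ->.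
rewrite [RHS](sum_enum_val (I := I)).
by apply: eq_bigr => i _; rewrite mxE enum_rankK enum_valK.
Qed.

(** * Darts, rotations and face orbits *)

Definition rev_dart (V : Type) (d : V * V) : V * V := (d.2, d.1).

Lemma rev_dartK (V : Type) : involutive (@rev_dart V).
Proof. by case. Qed.

Lemma darts_rev (V : finType) (G : rotation_system V) (d : V * V) :
  (rev_dart d \in darts G) = (d \in darts G).
Proof. by rewrite !inE adj_sym. Qed.

Lemma face_next_inj (V : finType) (G : rotation_system V) :
  injective (face_next G).
Proof. by move=> [u v] [u' v'] [<-] /perm_inj ->. Qed.

Lemma adj_rot (V : finType) (G : rotation_system V) (v u : V) :
  adj G v u -> adj G v (Defs.rot G v u).
Proof.
move=> vu; have := mem_porbit (Defs.rot G v) 1 u.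
by rewrite rotation_cycle // inE expg1.
Qed.

Lemma darts_face_next (V : finType) (G : rotation_system V) (d : V * V) :
  d \in darts G -> face_next G d \in darts G.
Proof. by rewrite !inE => ?; rewrite adj_rot // adj_sym. Qed.

Lemma darts_face_of (V : finType) (G : rotation_system V) (d d' : V * V) :
  d \in darts G -> d' \in face_of G d -> d' \in darts G.
Proof.
move=> dG; rewrite inE => /iter_findex <-.
by elim: (findex _ _ _) => //= n; exact: darts_face_next.
Qed.

Lemma face_of_next (V : finType) (G : rotation_system V) (d d' : V * V) :
  (face_next G d' \in face_of G d) = (d' \in face_of G d).
Proof. by rewrite !inE -same_fconnect1_r //; exact: face_next_inj. Qed.

Lemma neighbor_const (V : finType) (G : rotation_system V) (T : Type)
    (f : V -> T) (v : V) :
  (forall u, adj G v u -> f (Defs.rot G v u) = f u) ->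
  forall u w, adj G v u -> adj G v w -> f u = f w.
Proof.
move=> frot u w vu vw; have : w \in porbit (Defs.rot G v) u.
  by rewrite rotation_cycle // inE.
case/porbitP => n ->; elim: n => [|n IH]; first by rewrite expg0 perm1.
rewrite IH expgSr permM frot //.
by have := mem_porbit (Defs.rot G v) n u; rewrite rotation_cycle // inE.
Qed.

Lemma connected_const (V : finType) (G : plane_graph V) (T : eqType)
    (f : V -> T) :
  (forall u v, adj G u v -> f u = f v) -> forall u v, f u = f v.
Proof.
move=> fadj u v; have := pg_connected G u v.
have cl : fingraph.closed (adj G) [pred x | f x == f u].
  by move=> x y /fadj; rewrite !inE => ->.
by move/(closed_connect cl); rewrite !inE eqxx => /esym/eqP.
Qed.

(** * Gradients, face boundaries and circulations *)

(** A gradient telescopes around each face, as [face_next G d] starts where [d] ends. *)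
Lemma gradient_face_orthogonal (R : comRingType) (V : finType)
    (G : rotation_system V) (alpha : V * V -> R) (c : V -> R) :
  (forall d, alpha (face_next G d) = alpha d) ->
  \sum_d alpha d * (c d.2 - c d.1) = 0.
Proof.
move=> alphaN; under eq_bigr do rewrite mulrBr.
rewrite sumrB [X in _ - X](reindex_inj (@face_next_inj _ G)) /=.
by under [X in _ - X]eq_bigr do rewrite alphaN; rewrite subrr.
Qed.

(** Summation by parts: reversing darts turns the head terms into tail terms, which vanish vertex by
    vertex. *)
Lemma gradient_circulation_orthogonal (R : comRingType) (V : finType)
    (y : V * V -> R) (c : V -> R) :
  (forall d, y (rev_dart d) = - y d) -> (forall v, \sum_u y (v, u) = 0) ->
  \sum_d y d * (c d.2 - c d.1) = 0.
Proof.
move=> yN y0; under eq_bigr do rewrite mulrBr.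
have yc : \sum_d y d * c d.1 = 0.
  transitivity (\sum_u \sum_v y (u, v) * c u).
    by rewrite pair_bigA; apply: eq_bigr => -[].
  by rewrite big1 // => v _; rewrite -mulr_suml y0 mul0r.
rewrite sumrB yc (reindex_inj (can_inj (@rev_dartK V))) /=.
under eq_bigr do rewrite yN mulNr.
by rewrite sumrN yc oppr0 addr0.
Qed.

(* The gradient of c is orthogonal both to y and to the boundary of alpha. *)
Lemma hodge_gradient_eq0 (R : realFieldType) (V : finType)
    (G : rotation_system V) (y alpha : V * V -> R) (c : V -> R) :
  (forall d, d \notin darts G -> y d = 0) ->
  (forall d, y (rev_dart d) = - y d) -> (forall v, \sum_u y (v, u) = 0) ->
  (forall d, d \notin darts G -> alpha d = 0) ->
  (forall d, alpha (face_next G d) = alpha d) ->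
  (forall d, d \in darts G ->
     y d = c d.2 - c d.1 + (alpha d - alpha (rev_dart d))) ->
  forall d, d \in darts G -> c d.1 = c d.2.
Proof.
move=> yG yN y0 aG aN ydec d dG.
have supp (x : V * V -> R) : (forall d, d \notin darts G -> x d = 0) ->
    \sum_(d in darts G) x d * (c d.2 - c d.1) = \sum_d x d * (c d.2 - c d.1).
  move=> xG; rewrite [RHS](bigID [in darts G]) /= [X in _ + X]big1 ?addr0 //.
  by move=> e /xG ->; rewrite mul0r.
have ac : \sum_(d in darts G) alpha d * (c d.2 - c d.1) = 0.
  by rewrite supp // (gradient_face_orthogonal _ aN).
have arc : \sum_(d in darts G) alpha (rev_dart d) * (c d.2 - c d.1) = 0.
  rewrite (reindex_inj (can_inj (@rev_dartK V))) /=.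
  under eq_bigl do rewrite darts_rev.
  rewrite (eq_bigr (fun d => - (alpha d * (c d.2 - c d.1)))).
    by rewrite sumrN ac oppr0.
  by move=> e _; rewrite rev_dartK -mulrN opprB.
(* The squared norm of the gradient expands into pairings of the gradient with [y] and with the two
   parts of the boundary, all zero. *)
have : \sum_(d in darts G) (c d.2 - c d.1) ^+ 2 = 0.
  transitivity (\sum_(d in darts G) (y d * (c d.2 - c d.1) -
      alpha d * (c d.2 - c d.1) + alpha (rev_dart d) * (c d.2 - c d.1))).
    by apply: eq_bigr => e eG; rewrite ydec //; ring.
  rewrite big_split sumrB /= ac arc supp //.
  by rewrite gradient_circulation_orthogonal // subr0 addr0.
move/psumr_eq0P => /(_ (fun e _ => sqr_ge0 _) d dG)/eqP.
by rewrite sqrf_eq0 subr_eq0 => /eqP ->.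
Qed.

(** Reversing a dart and then taking [face_next] turns around a vertex, so [alpha] depends only on
    the tail of a dart; connectedness of the graph does the rest. *)
Lemma dual_connected_const (V : finType) (G : plane_graph V) (T : eqType)
    (alpha : V * V -> T) :
  (forall d, alpha (face_next G d) = alpha d) ->
  (forall d, d \in darts G -> alpha (rev_dart d) = alpha d) ->
  forall d d', d \in darts G -> d' \in darts G -> alpha d = alpha d'.
Proof.
move=> aN aR.
have aV v u w : adj G v u -> adj G v w -> alpha (v, u) = alpha (v, w).
  apply: (@neighbor_const _ G _ (fun u => alpha (v, u)) v) => x vx.
  by apply: etrans (aN (x, v)) (aR (v, x) _); rewrite inE.
pose beta v := [pick u | adj G v u].
pose f v := if beta v is Some u then Some (alpha (v, u)) else None.
have fE v u : adj G v u -> f v = Some (alpha (v, u)).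
  rewrite /f /beta; case: pickP => [w vw vu|/(_ u) -> //].
  by rewrite (aV v w u).
have fadj u v : adj G u v -> f u = f v.
  move=> uv; rewrite (fE u v) // (fE v u) 1?adj_sym //.
  by congr Some; apply/esym/(aR (u, v)); rewrite inE.
move=> [u v] [u' v']; rewrite !inE /= => uv uv'.
apply: Some_inj; rewrite -(fE u v) // -(fE u' v') //.
exact: connected_const fadj _ _.
Qed.

Lemma card_oriented_darts (V : finType) (G : rotation_system V) :
  #|[set d in darts G | (enum_rank d.1 < enum_rank d.2)%N]%SET| =
  #|darts G|./2.
Proof.
set O := [set d in _ | _]%SET.
suff -> : #|darts G| = #|O|.*2 by rewrite doubleK.
rewrite -(cardsID O (darts G)) -addnn; congr (_ + _)%N.
  by congr #|pred_of_set _|; apply/setP => d; rewrite !inE andbA andbb.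
rewrite -(card_imset O (can_inj (@rev_dartK V))).
congr #|pred_of_set _|; apply/setP => d.
rewrite (can_imset_pre _ (@rev_dartK V)) !inE /= [in RHS]adj_sym.
case: (boolP (adj G d.1 d.2)) => //= dG; rewrite ?andbF // andbT -leqNgt.
rewrite leq_eqVlt; case: eqP => //= /ord_inj/enum_rank_inj dd.
by rewrite -dd adj_irr in dG.
Qed.

(* Gradients are orthogonal to boundaries, so the kernel of                   *)
(* (c, alpha) |-> grad c + boundary alpha consists of the pairs of constants; *)
(* by genus 0 the map is then onto the antisymmetric functions on darts,      *)
(* coordinatised by the darts with d.1 before d.2.                            *)
Lemma hodge_decomposition (R : realFieldType) (V : finType)
    (G : plane_graph V) (y : V * V -> R) :
  (forall d, y (rev_dart d) = - y d) ->
  exists (c : V -> R) (alpha : V * V -> R),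
    [/\ forall d, d \notin darts G -> alpha d = 0,
        forall d, alpha (face_next G d) = alpha d
      & forall d, d \in darts G ->
          y d = c d.2 - c d.1 + (alpha d - alpha (rev_dart d))].
Proof.
move=> yN.
pose Fc := {f : {set V * V} | f \in faces G}.
pose O := [set d in darts G | (enum_rank d.1 < enum_rank d.2)%N]%SET.
pose J := {d : V * V | d \in O}.
pose b (i : V + Fc) (j : J) : R := match i with
  | inl v => (v == (val j).2)%:R - (v == (val j).1)%:R
  | inr f => (val j \in val f)%:R - (rev_dart (val j) \in val f)%:R
  end.
pose al (x : V + Fc -> R) d := \sum_f x (inr f) * (d \in val f)%:R.
have valF (f : Fc) : exists2 d0, d0 \in darts G & val f = face_of G d0.
  by case/imsetP: (valP f) => d0; exists d0.
have alG x d : d \notin darts G -> al x d = 0.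
  move=> dG; rewrite /al big1 // => f _; have [d0 d0G ->] := valF f.
  case: (boolP (d \in _)) => [/(darts_face_of d0G)|]; last by rewrite mulr0.
  by rewrite (negPf dG).
have alN x d : al x (face_next G d) = al x d.
  apply: eq_bigr => f _; have [d0 d0G ->] := valF f.
  by rewrite face_of_next.
have sumb x j : \sum_i x i * b i j =
    x (inl (val j).2) - x (inl (val j).1) +
    (al x (val j) - al x (rev_dart (val j))).
  have sum1 v : \sum_u x (inl u) * (u == v)%:R = x (inl v).
    rewrite (bigD1 v) //= eqxx mulr1 big1 ?addr0 // => u /negPf ->.
    by rewrite mulr0.
  rewrite big_sumType /= -!sumrB; congr (_ + _).
    by under eq_bigr do rewrite mulrBr; rewrite sumrB !sum1.
  by apply: eq_bigr => f _; rewrite mulrBr.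
have orient (z c : V * V -> R) : (forall d, z (rev_dart d) = - z d) ->
    (forall d, c (rev_dart d) = - c d) ->
    (forall j : J, z (val j) = c (val j)) ->
    forall d, d \in darts G -> z d = c d.
  move=> zN cN zc d dG.
  have [lt12|le21] := boolP (enum_rank d.1 < enum_rank d.2)%N.
    have dO : d \in O by rewrite inE dG.
    exact: (zc (exist _ d dO)).
  have dO : rev_dart d \in O.
    rewrite inE darts_rev dG /= ltn_neqAle leqNgt le21 andbT.
    apply: contraTneq dG => /ord_inj/enum_rank_inj dd.
    by rewrite inE -dd adj_irr.
  apply: oppr_inj; rewrite -zN -cN; exact: (zc (exist _ (rev_dart d) dO)).
pose hodge (x : V + Fc -> R) d :=
  x (inl d.2) - x (inl d.1) + (al x d - al x (rev_dart d)).
have hodgeN x d : hodge x (rev_dart d) = - hodge x d.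
  by rewrite /hodge rev_dartK opprD !opprB.
(* The indicators of all vertices and of all faces, which span the kernel. *)
pose e (k : bool) (i : V + Fc) : R :=
  (if i is inl _ then k else ~~ k)%:R.
have [||x xE] := @surjective_of_small_kernel R (V + Fc)%type J bool b e _ _
  (fun j => y (val j)); last first.
- exists (fun v => x (inl v)), (al x); split; [exact: alG | exact: alN |].
  move=> d; apply: (orient y (hodge x) yN (hodgeN x) _ d) => j.
  by rewrite xE sumb.
- rewrite card_sum !card_sig card_bool.
  rewrite (_ : #|[pred f | f \in faces G]| = #|faces G|); last exact: eq_card.
  rewrite pg_genus0 leq_add2r -card_oriented_darts.
  exact/subset_leq_card/fintype.subsetP.
move=> x x0.
have xh d : d \in darts G -> 0 = hodge x d.
  apply: (orient (fun=> 0) (hodge x) _ (hodgeN x) _ d) => [d'|j].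
    by rewrite oppr0.
  exact: etrans (esym (x0 j)) (sumb x j).
(* The zero function is a circulation, so the gradient vanishes, and then the boundary does too. *)
have cE : forall d, d \in darts G -> x (inl d.1) = x (inl d.2).
  apply: (@hodge_gradient_eq0 R V G (fun=> 0) (al x) (x \o inl)) => //.
  - by move=> d; rewrite oppr0.
  - by move=> v; rewrite big1.
  - exact: alG.
have cC u v : x (inl u) = x (inl v).
  apply: (@connected_const _ G _ (x \o inl)) => a a' adja.
  by apply: (cE (a, a')); rewrite inE.
have aC : forall d d', d \in darts G -> d' \in darts G -> al x d = al x d'.
  apply: dual_connected_const => // d dG.
  have := xh d dG; rewrite /hodge cE // subrr add0r => /esym/eqP.
  by rewrite subr_eq0 => /eqP.
exists (fun k => if k then x (inl (pg_outer G).1) else al x (pg_outer G)).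
case=> [v|f]; rewrite big_bool /e /= mulr1 mulr0 ?addr0 ?add0r; first exact: cC.
have [d0 d0G fE] := valF f.
(* The dart [d0] lies in the face [f] only, so [al x d0] is the coefficient of [f]. *)
rewrite -(aC d0) ?pg_outer_dart // /al (bigD1 f) //= fE inE connect0 mulr1.
rewrite big1 ?addr0 // => g gf; have [d1 d1G gE] := valF g.
case: (boolP (d0 \in _)) => [|]; last by rewrite mulr0.
rewrite gE inE => d10; case/eqP: gf; apply: val_inj; rewrite fE gE.
apply/setP => d; rewrite !inE.
by rewrite (same_connect (fconnect_sym (@face_next_inj _ G)) d10).
Qed.

Lemma circulation_boundary (R : realFieldType) (V : finType)
    (G : plane_graph V) (y : V * V -> R) :
  (forall d, d \notin darts G -> y d = 0) ->
  (forall d, y (rev_dart d) = - y d) -> (forall v, \sum_u y (v, u) = 0) ->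
  exists2 alpha : V * V -> R, forall d, alpha (face_next G d) = alpha d
    & forall d, d \in darts G -> y d = alpha d - alpha (rev_dart d).
Proof.
move=> yG yN y0; have [c [alpha [aG aN ydec]]] := hodge_decomposition G yN.
exists alpha => // d dG.
rewrite ydec // (@hodge_gradient_eq0 _ _ G y alpha c) //.
by rewrite subrr add0r.
Qed.

(** * Potentials on the internal vertices *)

Lemma face_vertexS (V : finType) (G : rotation_system V) (d : V * V) (n : nat) :
  face_vertex G d n.+1 = (iter n (face_next G) d).2.
Proof. by rewrite /face_vertex iterS. Qed.

Lemma face_vertex_length (V : finType) (G : rotation_system V) (d : V * V) :
  face_vertex G d (face_length G d) = d.1.
Proof.
by rewrite /face_vertex /face_length iter_order //; exact: face_next_inj.
Qed.

Lemma iter_face_of (V : finType) (G : rotation_system V) (d : V * V) (n : nat) :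
  iter n (face_next G) d \in face_of G d.
Proof. by rewrite inE fconnect_iter. Qed.

Lemma internal_face_edge (V : finType) (G : plane_graph V) (d : V * V)
    (n : nat) :
  d \in darts G -> strictly_internal_face G d ->
  let v := face_vertex G d in
  [/\ adj G (v n) (v n.+1), internal G (v n) & internal G (v n.+1)].
Proof.
move=> dG /forall_inP dI /=; rewrite face_vertexS; split.
- by have := darts_face_of dG (iter_face_of G d n); rewrite inE.
- exact/dI/iter_face_of.
- by rewrite -face_vertexS; exact/dI/iter_face_of.
Qed.

Lemma sum_face_of (M : nmodType) (V : finType) (G : rotation_system V)
    (F : V * V -> M) (d : V * V) :
  \sum_(d' in face_of G d) F d' =
  \sum_(i < face_length G d) F (iter i (face_next G) d).
Proof.
transitivity (\sum_(d' <- orbit (face_next G) d) F d').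
  rewrite big_uniq ?orbit_uniq //=.
  by apply: eq_bigl => d'; rewrite inE fconnect_orbit.
rewrite (big_nth d) size_orbit big_mkord; apply: eq_bigr => i _.
by rewrite nth_traject.
Qed.

Lemma face_of_eq (V : finType) (G : rotation_system V) (d d' : V * V) :
  (face_of G d' == face_of G d) = (d' \in face_of G d).
Proof.
have symF := fconnect_sym (@face_next_inj _ G).
apply/eqP/idP => [<-|]; first by rewrite inE connect0.
rewrite inE => dd'; apply/setP => e.
by rewrite !inE (same_connect symF dd').
Qed.

(* By the Fredholm alternative it suffices that omega is orthogonal to every  *)
(* circulation on the internal vertices.  Such a circulation is a combination *)
(* of face boundaries in which all faces around an external vertex have the   *)
(* coefficient of the outer face, so that only strictly internal faces count. *)
Lemma internal_potential (R : realFieldType) (V : finType) (G : plane_graph V)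
    (omega : V * V -> R) :
  (forall d, omega (rev_dart d) = - omega d) ->
  (forall d, d \in darts G -> strictly_internal_face G d ->
     \sum_(d' in face_of G d) omega d' = 0) ->
  exists c : V -> R, forall u v, adj G u v -> internal G u -> internal G v ->
    omega (u, v) = c v - c u.
Proof.
move=> omN omF.
pose H (d : V * V) := [&& adj G d.1 d.2, internal G d.1 & internal G d.2].
have Hrev d : H (rev_dart d) = H d.
  by rewrite /H /= adj_sym [internal G d.2 && _]andbC.
pose b v (d : V * V) : R := ((v == d.2)%:R - (v == d.1)%:R) * (H d)%:R.
pose om d := omega d * (H d)%:R.
have sumb (c : V -> R) d : \sum_v c v * b v d = (c d.2 - c d.1) * (H d)%:R.
  have sum1 u : \sum_v c v * (v == u)%:R = c u.
    rewrite (bigD1 u) //= eqxx mulr1 big1 ?addr0 // => v /negPf ->.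
    by rewrite mulr0.
  under eq_bigr do rewrite mulrA mulrBr.
  by rewrite -mulr_suml sumrB !sum1.
suff [c cE] : exists c, forall d, om d = \sum_v c v * b v d.
  exists c => u v uv iu iv; have := cE (u, v).
  by rewrite sumb /om /H /= uv iu iv !mulr1.
apply: fredholm_alternative => x x0.
(* Each [b v] is antisymmetric, so [x0] gives the antisymmetrised [y] zero net flow at every
   vertex. *)
pose y d := (x d - x (rev_dart d)) * (H d)%:R.
have yN d : y (rev_dart d) = - y d.
  by rewrite /y Hrev rev_dartK -mulNr opprB.
have yH d : ~~ H d -> y d = 0 by rewrite /y => /negPf ->; rewrite mulr0.
have omH d : ~~ H d -> om d = 0 by rewrite /om => /negPf ->; rewrite mulr0.
have omrev d : om (rev_dart d) = - om d by rewrite /om Hrev omN mulNr.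
have yG d : d \notin darts G -> y d = 0.
  by move=> dG; apply: yH; rewrite inE in dG; rewrite /H (negPf dG).
have sum_rev (f : V * V -> R) : \sum_d f (rev_dart d) = \sum_d f d.
  by rewrite [RHS](reindex_inj (can_inj (@rev_dartK V))).
have sum_star (f : V * V -> R) v :
    \sum_u f (v, u) = \sum_d (v == d.1)%:R * f d.
  transitivity (\sum_u \sum_w (v == u)%:R * f (u, w)).
    rewrite [RHS](bigD1 v) //= eqxx [X in _ + X]big1 ?addr0.
      by apply: eq_bigr => w _; rewrite mul1r.
    move=> u uv; rewrite big1 // => w _.
    by rewrite eq_sym (negPf uv) mul0r.
  by rewrite pair_bigA; apply: eq_bigr => -[].
have y0 v : \sum_u y (v, u) = 0.
  rewrite sum_star; transitivity (\sum_d (v == d.1)%:R * (H d)%:R * x d -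
      \sum_d (v == d.2)%:R * (H d)%:R * x d).
    rewrite -[X in _ - X]sum_rev -sumrB; apply: eq_bigr => d _.
    by rewrite Hrev /y /=; ring.
  apply: oppr_inj; rewrite oppr0 -[RHS](x0 v) -sumrB -sumrN.
  apply: eq_bigr => d _.
  by rewrite /b; ring.
have [al aN yE] := circulation_boundary yG yN y0.
pose d0 := pg_outer G; have d0G : d0 \in darts G := pg_outer_dart G.
have al_face d d' : d' \in face_of G d -> al d' = al d.
  rewrite inE => /iter_findex <-.
  by elim: (findex _ _ _) => //= n; rewrite aN.
(* No edge at an external vertex satisfies [H], so [y] vanishes there and [al] agrees on both sides
   of the edge; turning around the vertex reaches the outer face. *)
have al_ext v u : adj G v u -> external G v -> al (v, u) = al d0.
  move=> vu ext; case/existsP: (ext) => -[v' w] /andP[dO /eqP /= v'v].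
  subst v'.
  rewrite /outer_face -/d0 in dO; rewrite -(al_face _ _ dO).
  apply: (@neighbor_const _ G _ (fun u => al (v, u)) v) => //; last first.
    by have := darts_face_of d0G dO; rewrite inE.
  move=> t vt; apply: etrans (aN (t, v)) _; apply/esym/eqP.
  rewrite -subr_eq0 -[al (t, v)]/(al (rev_dart (v, t))) -yE ?inE //.
  by rewrite yH // /H /= /internal; apply/negP => /and3P[_ /negP].
have al_nint d : d \in darts G -> ~~ strictly_internal_face G d ->
    al d = al d0.
  move=> dG /forall_inPn[[v u] dF /negPn ext].
  rewrite -(al_face _ _ dF) al_ext //.
  by have := darts_face_of dG dF; rewrite inE.
(* Subtracting [al d0] preserves boundaries and kills every face that is not strictly internal;
   [omF] handles the others. *)
have omal : \sum_(d in darts G) om d * (al d - al d0) = 0.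
  rewrite (partition_big (face_of G) [in faces G]) /=; last first.
    by move=> d dG; apply: imset_f.
  rewrite big1 // => f /imsetP[d dG ->].
  rewrite (eq_bigl [in face_of G d]); last first.
    by move=> d'; rewrite face_of_eq andb_idl //; exact: darts_face_of.
  rewrite (eq_bigr (fun d' => om d' * (al d - al d0))); last first.
    by move=> d' /al_face ->.
  rewrite -mulr_suml.
  have [dI|dI] := boolP (strictly_internal_face G d); last first.
    by rewrite al_nint // subrr mulr0.
  rewrite (eq_bigr omega) ?omF ?mul0r // => d' d'F.
  rewrite /om; suff -> : H d' by rewrite mulr1.
  have /iter_findex <- : fconnect (face_next G) d d' by rewrite inE in d'F.
  have := internal_face_edge (findex (face_next G) d d') dG dI.
  by rewrite /= face_vertexS => -[? ? ?]; apply/and3P.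
have omG (f : V * V -> R) :
    \sum_d om d * f d = \sum_(d in darts G) om d * f d.
  rewrite (bigID [in darts G]) /= [X in _ + X]big1 ?addr0 // => d dG.
  by rewrite omH ?mul0r // /H; rewrite inE in dG; rewrite (negPf dG).
have om_anti (f : V * V -> R) :
    \sum_d om d * (f d - f (rev_dart d)) = 2 * \sum_d om d * f d.
  under eq_bigr do rewrite mulrBr.
  rewrite sumrB -[X in _ - X]sum_rev.
  under [X in _ - X]eq_bigr do rewrite rev_dartK omrev mulNr.
  by rewrite sumrN opprK mulr2n mulrDl !mul1r.
(* Twice the sum pairs [om] with the antisymmetrised [x], which on [H] is the boundary of
   [al - al d0]. *)
apply/eqP; rewrite -(mulrI_eq0 _ (@mulfI _ 2 _)) ?pnatr_eq0 // -om_anti.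
rewrite (eq_bigr (fun d =>
    om d * ((al d - al d0) - (al (rev_dart d) - al d0)))).
  by rewrite (om_anti (fun d => al d - al d0)) omG omal mulr0.
move=> d _; have [dG|dG] := boolP (d \in darts G); last first.
  by rewrite omH ?mul0r // /H; rewrite inE in dG; rewrite (negPf dG).
have [Hd|/omH ->] := boolP (H d); last by rewrite !mul0r.
by rewrite opprB addrA subrK -yE // /y Hd mulr1.
Qed.

(** * Products around faces and the weights *)

Lemma face_weights_product (R : fieldType) (V : finType) (G : plane_graph V)
    (w : V -> V -> R) (s : V -> R) (d : V * V) :
  (forall i j, internal_edge G i j -> w i j = w j i) ->
  d \in darts G -> strictly_internal_face G d ->
  let v := face_vertex G d in
  let k := face_length G d in
  \prod_(0 <= i < k) (w (v i) (v i.+1) / s (v i)) =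
  \prod_(1 <= i < k.+1) (w (v i) (v i.-1) / s (v i)).
Proof.
move=> wC dG dI v k; rewrite big_add1 /= !big_split /=; congr (_ * _).
  apply: eq_bigr => i _; have [vv iv _] := internal_face_edge i dG dI.
  by apply: wC; rewrite /internal_edge vv iv.
(* The two products of inverse sums differ by an index shift, harmless since the walk closes up. *)
have vk : v k = v 0 by exact: face_vertex_length.
have : k != 0%N by rewrite /k /face_length -orderSpred.
case: k vk => // k vk _.
by rewrite big_nat_recl // big_nat_recr //= vk mulrC.
Qed.

Lemma ln_prod (R : realType) (I : Type) (r : seq I) (F : I -> R) :
  (forall i, 0 < F i) -> ln (\prod_(i <- r) F i) = \sum_(i <- r) ln (F i).
Proof.
move=> F0; elim: r => [|i r IH]; first by rewrite !big_nil ln1.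
by rewrite !big_cons lnM ?IH // posrE // prodr_gt0.
Qed.

(** Makes the normalising sum at an internal vertex nonempty, hence positive: a path to a second
    vertex starts with an edge. *)
Lemma triconnected_neighbor (V : finType) (G : plane_graph V) (v : V) :
  triconnected G -> exists u, adj G v u.
Proof.
case=> V3 _; have [u vu] : exists u, u != v.
  have /card_gt0P[u] : (0 < #|predC1 v|)%N.
    by rewrite cardC1; lia.
  by exists u.
case/connectP: (pg_connected G v u) => -[|w p] /=.
  by move=> _ uv; rewrite uv eqxx in vu.
by case/andP => vw _ _; exists w.
Qed.

Theorem corollary4 (R : realType) (V : finType) (G : plane_graph V)
    (gamma : V -> 'rV[R]_2) :
  triconnected G ->
  straight_line_planar_drawing G gamma ->
  hull_is_outer_face G gamma ->
  weighted_barycenter_drawing G gamma <->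
  exists z : V -> V -> R,
    [/\ forall i j, internal G i -> adj G i j -> 0 < z i j,
        forall i, internal G i ->
          \sum_(j | adj G i j) z i j = 1 /\
          gamma i = \sum_(j | adj G i j) z i j *: gamma j
      & forall d, d \in darts G -> strictly_internal_face G d ->
          let v := face_vertex G d in
          let k := face_length G d in
          \prod_(0 <= i < k) z (v i) (v i.+1) =
          \prod_(1 <= i < k.+1) z (v i) (v i.-1)].
Proof.
move=> tri _ _; split=> [[w [wE wbar]] | [z [zpos zbar zface]]].
  pose s i := \sum_(j | adj G i j) w i j.
  have wpos i j : internal G i -> adj G i j -> 0 < w i j.
    by move=> ii ij; apply: (wE i j _).2; rewrite /internal_edge ij ii.
  have spos i : internal G i -> 0 < s i.
    move=> ii; have [j ij] := triconnected_neighbor i tri.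
    rewrite /s (bigD1 j) //= ltr_pwDl ?wpos // sumr_ge0 // => k /andP[ik _].
    by rewrite ltW // wpos.
  exists (fun i j => w i j / s i); split.
  - by move=> i j ii ij; rewrite divr_gt0 ?wpos ?spos.
  - move=> i ii; split; first by rewrite -mulr_suml divff // gt_eqF // spos.
    rewrite [LHS]wbar // scaler_sumr; apply: eq_bigr => j _.
    by rewrite scalerA mulrC mul1r.
  - move=> d dG dI; apply: face_weights_product => // i j ij.
    by case: (wE i j ij).
pose H i j := [&& adj G i j, internal G i & internal G j].
(* The value 1 keeps the logarithms antisymmetric away from H, where z may be *)
(* nonpositive.                                                               *)
pose zH i j := if H i j then z i j else 1.
have zHpos i j : 0 < zH i j.
  by rewrite /zH; case: ifP => // /and3P[ij ii _]; apply: zpos.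
pose omega (d : V * V) := ln (zH d.1 d.2) - ln (zH d.2 d.1).
have [||c cE] := @internal_potential R V G omega.
- by move=> d; rewrite /omega opprB.
- move=> d dG dI; have zHE n :
      zH (face_vertex G d n) (face_vertex G d n.+1) =
        z (face_vertex G d n) (face_vertex G d n.+1) /\
      zH (face_vertex G d n.+1) (face_vertex G d n) =
        z (face_vertex G d n.+1) (face_vertex G d n).
    have [vv iv iv'] := internal_face_edge n dG dI.
    by rewrite /zH /H vv iv iv' adj_sym vv.
  rewrite sum_face_of sumrB -(ln_prod _ (fun=> zHpos _ _)).
  rewrite -(ln_prod _ (fun=> zHpos _ _)); apply/eqP; rewrite subr_eq0.
  apply/eqP; congr ln; have /= := zface d dG dI; rewrite big_add1 /= !big_mkord.
  set lhs := (X in X = _); set rhs := (X in _ = X) => E.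
  transitivity lhs; last rewrite E; apply: eq_bigr => i _;
    by case: (zHE i); rewrite face_vertexS.
have zc i j : adj G i j -> internal G i -> internal G j ->
    expR (c i) * z i j = expR (c j) * z j i.
  move=> ij ii ij'; have ji : adj G j i by rewrite adj_sym.
  have := cE i j ij ii ij'; rewrite /omega /zH /H /= ij ji ii ij' /= => E.
  have zi : 0 < z i j by apply: zpos.
  have zj : 0 < z j i by apply: zpos.
  apply: ln_inj; rewrite ?posrE ?mulr_gt0 ?expR_gt0 //.
  by rewrite !lnM ?posrE ?expR_gt0 // !expRK; lra.
(* With both ends internal the two formulas agree by [zc]; otherwise the internal end supplies the
   weight. The weights at an internal [i] then sum to [expR (c i)]. *)
pose w i j := if internal G i then expR (c i) * z i j
  else expR (c j) * z j i.
exists w; split=> [i j /andP[ij int]|i ii].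
  have ji : adj G j i by rewrite adj_sym.
  rewrite /w; case: ifP int => [ii _|_ /= ij'].
    split; last by rewrite mulr_gt0 ?expR_gt0 ?zpos.
    by case: ifP => // ij'; apply: zc.
  by rewrite ij' mulr_gt0 ?expR_gt0 ?zpos.
have [z1 zg] := zbar i ii.
rewrite /w ii -mulr_sumr z1 mulr1 {1}zg scaler_sumr.
apply: eq_bigr => j _; rewrite scalerA mulrA mul1r mulVf ?mul1r //.
by rewrite gt_eqF // expR_gt0.
Qed.
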